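(* Let $d\in\{1,2\}$, $\nu>0$, $\mu>0$, $\gamma>0$. Then both sequences $(\alpha_k^{(\nu,\gamma)})_{k\ge0}$ and $(c_n^{(\nu,\mu)})_{n\ge0}$ are Hausdorff moment sequences, i.e. each is of the form $s_n=\int_0^1x^n\,d\rho(x)$, $n=0,1,\dots$, for some positive measure $\rho$ on $[0,1]$.
   Context: $\alpha_k^{(\nu,\gamma)}=\frac{\Gamma(k+\frac d2)}{k!\,\Gamma(\frac d2)\Gamma(\nu)}\gamma^{2k}\int_0^{\infty}e^{-a}a^{\nu+\frac d2-1}(a+\gamma^2)^{-k-\frac d2}\,da$ and $c_n^{(\nu,\mu)}=\frac{1}{B(\nu,\mu)}\frac{(\frac d2)_n}{n!}\int_0^1 t^{\mu+\frac d2-1}(1-t)^{\nu+\frac d2-1}(1-t+t^2)^n\,dt$, where $B$ is the Beta function and $(a)_n$ the Pochhammer symbol. *)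

(* Defs.v *)
From HB Require Import structures.
From mathcomp Require Import all_boot all_order all_algebra.
From mathcomp Require Import all_classical all_reals all_analysis.
Set Implicit Arguments. Unset Strict Implicit. Unset Printing Implicit Defensive.
Import Order.TTheory GRing.Theory Num.Theory.
Import numFieldNormedType.Exports.
Local Open Scope classical_set_scope.
Local Open Scope ring_scope.

Section Defs.
Variable R : realType.
Notation leb := (@lebesgue_measure R).

Definition Gamma (s : R) : R :=
  Rintegral leb `]0%R, +oo[ (fun x => x `^ (s - 1) * expR (- x)).

Definition Beta (a b : R) : R :=
  Rintegral leb `[0%R, 1%R] (fun t => t `^ (a - 1) * (1 - t) `^ (b - 1)).

Definition pochhammer (a : R) (n : nat) : R := \prod_(i < n) (a + i%:R).

Definition alpha (d : nat) (nu gam : R) (k : nat) : R :=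
  Gamma (k%:R + d%:R / 2) / ((k`!)%:R * Gamma (d%:R / 2) * Gamma nu)
  * gam ^+ (2 * k)
  * Rintegral leb `]0%R, +oo[
      (fun a => expR (- a) * a `^ (nu + d%:R / 2 - 1)
                * (a + gam ^+ 2) `^ (- k%:R - d%:R / 2)).

Definition cseq (d : nat) (nu mu : R) (n : nat) : R :=
  1 / Beta nu mu * (pochhammer (d%:R / 2) n / (n`!)%:R)
  * Rintegral leb `[0%R, 1%R]
      (fun t => t `^ (mu + d%:R / 2 - 1) * (1 - t) `^ (nu + d%:R / 2 - 1)
                * (1 - t + t ^+ 2) ^+ n).

(* Hausdorff moment sequence: s_n = int_[0,1] x^n d rho(x) for a positive
   measure rho (a measure on the Borel sets of R, restricted to [0,1]). *)
Definition hausdorff_moment (s : nat -> R) : Prop :=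
  exists rho : {measure set R -> \bar R},
    forall n : nat, (\int[rho]_(x in `[0%R, 1%R]) ((x ^+ n)%:E) = (s n)%:E)%E.
End Defs.

(* Main.v *)
(** Up to nonnegative constants both sequences are the product of
    [(d/2)_n / n!] and an integral [\int w * phi ^+ n] with [w >= 0] and
    [0 <= phi <= 1].  The latter is the moment sequence of the image under [phi]
    of the measure with density [w].  The former is constant for [d = 2], and
    for [d = 1] it is Wallis' [1/pi * \int_0^pi (sin x)^(2n) dx].  Products of
    moment sequences are moment sequences of multiplicative convolutions.  For
    [alpha], the recurrence of the Gamma function turns
    [Gamma (k + d/2) / Gamma (d/2)] into the Pochhammer symbol. *)

Require Import Defs.
From HB Require Import structures.
From mathcomp Require Import all_boot all_order all_algebra.
From mathcomp Require Import all_classical all_reals all_analysis.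
From mathcomp Require Import measurable_realfun ring lra.
Import Order.TTheory GRing.Theory Num.Theory.
Import numFieldNormedType.Exports.
Local Open Scope classical_set_scope.
Local Open Scope ring_scope.
Set Implicit Arguments. Unset Strict Implicit. Unset Printing Implicit Defensive.

(** * Operations that produce Hausdorff moment sequences *)

(** The representing measure is the image of [m] under [psi], and change of variables gives its
    moments. The product and density constructions below both end here. *)
Lemma hausdorff_moment_integral d (T : measurableType d) (R : realType)
    (m : {measure set T -> \bar R}) (D : set T) (psi : T -> R) (s : nat -> R) :
  measurable D -> measurable_fun D psi ->
  (forall x, D x -> 0 <= psi x <= 1) ->
  (forall n, (\int[m]_(x in D) (psi x ^+ n)%:E = (s n)%:E)%E) ->
  hausdorff_moment s.
Proof.
move=> mD mpsi psi01 hs.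
(* The value [-1] lies outside [0, 1], so only [D] contributes. *)
pose f x := if x \in D then psi x else -1.
have mf : measurable_fun setT f.
  apply: measurable_fun_if => //.
  - by apply: (measurable_fun_bool true); rewrite setTI preimage_mem_true.
  - by rewrite setTI preimage_mem_true.
have fD : f @^-1` `[0, 1] = D.
  apply/seteqP; split => x /=; rewrite /f in_itv/=.
    case: ifPn => [|_]; first by rewrite inE.
    by rewrite lerNr oppr0 ler10.
  by move=> Dx; rewrite mem_set//; exact: psi01.
unshelve eexists (pushforward m f); first exact: mf.
move=> n.
rewrite (ge0_integral_pushforward mf)//=; last 2 first.
- by apply/measurable_EFinP; exact: exprn_measurable.
- by move=> y; rewrite inE/= in_itv/= => /andP[y0 _]; rewrite lee_fin exprn_ge0.
rewrite fD -hs; apply: eq_integral => x xD /=.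
by rewrite /f xD.
Qed.

Lemma hausdorff_momentZ (R : realType) (c : R) (s : nat -> R) :
  0 <= c -> hausdorff_moment s -> hausdorff_moment (fun n => c * s n).
Proof.
move=> c0 [rho hs]; exists (mscale (NngNum c0) rho) => n.
rewrite ge0_integral_mscale//=; last 2 first.
- by apply/measurable_EFinP; exact: exprn_measurable.
- by move=> x; rewrite /= in_itv/= => /andP[x0 _]; rewrite lee_fin exprn_ge0.
by rewrite hs EFinM.
Qed.

Lemma hausdorff_moment1 (R : realType) : hausdorff_moment (fun=> 1 : R).
Proof.
exists \d_(1 : R) => n; rewrite integral_dirac//=.
  by rewrite expr1n diracE mem_set ?mul1e//= in_itv/= ler01 lexx.
by apply/measurable_EFinP; exact: exprn_measurable.
Qed.

(** Push the product of the two representing measures forward under multiplication; Tonelli splits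
    the integral of [(x * y) ^+ n] into the two moments. *)
Lemma hausdorff_momentM (R : realType) (s t : nat -> R) :
  hausdorff_moment s -> hausdorff_moment t ->
  hausdorff_moment (fun n => s n * t n).
Proof.
move=> [rho1 h1] [rho2 h2]; pose I : set R := `[0, 1]%classic.
have mI : measurable I by exact: measurable_itv.
(* The zeroth moment is the mass of [I], so it is finite. A representing measure may be arbitrary
   outside [I]; restricting it to [I] yields the finite measure that the product construction
   requires. *)
have fin (rho : {measure set R -> \bar R}) u :
    (forall n, (\int[rho]_(x in I) (x ^+ n)%:E = (u n)%:E)%E) ->
    (rho I < +oo)%E.
  move=> /(_ 0%N).
  under eq_integral do rewrite expr0.
  by rewrite integral_cst// mul1e => ->; rewrite ltry.
pose m1 : {finite_measure set R -> \bar R} := mfrestr mI (fin _ _ h1).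
pose m2 : {finite_measure set R -> \bar R} := mfrestr mI (fin _ _ h2).
have restrE (rho : {measure set R -> \bar R}) (fi : (rho I < +oo)%E) n :
    (\int[mfrestr mI fi]_(x in I) (x ^+ n)%:E = \int[rho]_(x in I) (x ^+ n)%:E)%E.
  apply: eq_measure_integral => A mA AI.
  by rewrite /= /mfrestr /mrestr setIidl.
(* The integrand is extended by zero, because Tonelli is applied on the whole plane. *)
pose f n (z : R * R) : \bar R :=
  ((fun z => ((z.1 * z.2) ^+ n)%:E) \_ (I `*` I)) z.
have mII : measurable (I `*` I) by exact: measurableX.
have mmul : measurable_fun setT (fun z : R * R => z.1 * z.2).
  by apply: measurable_funM; [exact: measurable_fst|exact: measurable_snd].
have f0 n z : (0 <= f n z)%E.
  rewrite /f patchE; case: ifPn => //; rewrite inE/= /I/= !in_itv/=.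
  move=> [/andP[? _] /andP[? _]].
  by rewrite lee_fin exprn_ge0// mulr_ge0.
have mf n : measurable_fun setT (f n).
  apply/(measurable_restrictT _ _).1 => //.
  apply/measurable_EFinP; apply: (measurable_funX n).
  exact: measurable_funTS.
apply: (@hausdorff_moment_integral _ _ R (m1 \x m2)%E (I `*` I)
  (fun z => z.1 * z.2)).
- exact: mII.
- exact: measurable_funTS.
- move=> z [] /=; rewrite /I/= !in_itv/= => /andP[? ?] /andP[? ?].
  by rewrite mulr_ge0//= mulr_ile1.
- move=> n; rewrite integral_mkcond.
  rewrite [LHS](fubini_tonelli1 _ (mf n) (f0 n)).
  transitivity (\int[m1]_(x in I) ((x ^+ n)%:E * (t n)%:E))%E.
    rewrite [RHS]integral_mkcond; apply: eq_integral => x _.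
    rewrite /fubini_F patchE; case: ifPn => xI.
      rewrite -h2 -(restrE _ (fin _ _ h2)). rewrite -ge0_integralZl//.
      + rewrite [RHS]integral_mkcond; apply: eq_integral => y _.
        rewrite /f !patchE.
        rewrite in_setX/= xI/=; case: ifPn => // _.
        by rewrite exprMn EFinM.
      + by apply/measurable_EFinP; exact: exprn_measurable.
      + move=> y; rewrite /I/= in_itv/= => /andP[y0 _].
        by rewrite lee_fin exprn_ge0.
      + move: xI; rewrite inE /I/= in_itv/= => /andP[x0 _].
        by rewrite lee_fin exprn_ge0.
    rewrite integral0_eq// => y _.
    by rewrite /f patchE in_setX/= (negbTE xI).
  rewrite ge0_integralZr//. 
  + by rewrite restrE h1 EFinM.
  + by apply/measurable_EFinP; exact: exprn_measurable.
  + move=> y; rewrite /I/= in_itv/= => /andP[y0 _].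
    by rewrite lee_fin exprn_ge0.
  + rewrite -h2 integral_ge0// => y; rewrite /I/= in_itv/= => /andP[y0 _].
    by rewrite lee_fin exprn_ge0.
Qed.

(** * Measures with an integrable density *)

Lemma le1_integrableM d (T : measurableType d) (R : realType)
    (mu : {measure set T -> \bar R}) (D : set T) (w g : T -> R) :
  measurable D -> measurable_fun D g -> (forall x, D x -> 0 <= g x <= 1) ->
  mu.-integrable D (EFin \o w) ->
  mu.-integrable D (EFin \o (fun x => w x * g x)).
Proof.
move=> mD mg g01 iw.
have mw : measurable_fun D w by case/integrableP : iw => /measurable_EFinP.
apply: le_integrable iw => //.
  by apply/measurable_EFinP; exact: measurable_funM.
move=> x Dx /=; have /andP[g0 g1] := g01 _ Dx.
by rewrite lee_fin normrM ler_piMr// ger0_norm.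
Qed.

(* The measure with density [w] is the image of Lebesgue measure on the region
   under the graph of [w]; this turns the moment integral into Tonelli. *)
Lemma hausdorff_moment_density d (T : measurableType d) (R : realType)
    (mu : {sigma_finite_measure set T -> \bar R}) (D : set T) (w phi : T -> R) :
  measurable D -> measurable_fun D phi ->
  (forall x, D x -> 0 <= w x) -> (forall x, D x -> 0 <= phi x <= 1) ->
  mu.-integrable D (EFin \o w) ->
  hausdorff_moment (fun n => \int[mu]_(x in D) (w x * phi x ^+ n)).
Proof.
move=> mD mphi w0 phi01 iw.
have mw : measurable_fun D w by case/integrableP : iw => /measurable_EFinP.
have mw1 : measurable_fun setT (w \_ D).
  exact/(measurable_restrictT _ mD).1.
have mphi1 : measurable_fun setT (phi \_ D).
  exact/(measurable_restrictT _ mD).1.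
pose leb := @lebesgue_measure R.
pose S : set (T * measurableTypeR R) :=
  [set z | [/\ D z.1, 0 <= z.2 & z.2 <= w z.1]].
have mS : measurable S.
  (* For measurability, the condition [z.2 <= w z.1] is read as a preimage of a half-line under a
     difference of measurable functions. *)
  rewrite (_ : S = (D `*` `[0, +oo[%classic) `&`
      (fun z : T * measurableTypeR R => (w \_ D) z.1 - z.2) @^-1` `[0, +oo[%classic).
    apply: measurableI; first exact: measurableX.
    rewrite -[X in measurable X]setTI.
    have : measurable_fun setT
        (fun z : T * measurableTypeR R => (w \_ D) z.1 - z.2).
      apply: measurable_funB; last exact: measurable_snd.
      exact: (measurableT_comp mw1 measurable_fst).
    by apply.
  apply/seteqP; split => -[x y]; rewrite /S /= !in_itv/= !andbT subr_ge0.
    by move=> [Dx y0 yw]; rewrite patchE mem_set.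
  by move=> [[Dx y0]]; rewrite patchE mem_set.
have mpsi : measurable_fun setT
    (fun z : T * measurableTypeR R => (phi \_ D) z.1).
  exact: (measurableT_comp mphi1 measurable_fst).
apply: (@hausdorff_moment_integral _ _ R (mu \x leb)%E S
  (fun z => (phi \_ D) z.1)).
- exact: mS.
- exact: measurable_funTS.
- by move=> z [Dz _ _]; rewrite patchE mem_set//; exact: phi01.
move=> n.
pose f (z : T * measurableTypeR R) : \bar R :=
  ((fun z => ((phi \_ D) z.1 ^+ n)%:E) \_ S) z.
have f0 z : (0 <= f z)%E.
  rewrite /f patchE; case: ifPn => //; rewrite inE => -[Dz _ _].
  by rewrite patchE mem_set// lee_fin exprn_ge0//; have /andP[] := phi01 _ Dz.
have mf : measurable_fun setT f.
  refine ((measurable_restrictT (fun z => ((phi \_ D) z.1 ^+ n)%:E) mS).1 _).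
  by apply/measurable_EFinP; apply: measurable_funX; exact: measurable_funTS.
rewrite integral_mkcond [LHS](fubini_tonelli1 _ mf f0).
(* [Rintegral] is the [fine] of an extended integral; removing [fine] requires finiteness, which
   holds because [phi ^+ n] is at most 1. *)
rewrite fineK; last first.
  apply: integrable_fin_num => //; apply: le1_integrableM => //.
    exact: measurable_funX.
  move=> x Dx; have /andP[p0 p1] := phi01 _ Dx.
  by rewrite exprn_ge0//= exprn_ile1.
rewrite [RHS]integral_mkcond; apply: eq_integral => x _.
rewrite /fubini_F patchE; case: ifPn => xD; last first.
  rewrite integral0_eq// => y _; rewrite /f patchE; case: ifPn => //.
  by rewrite inE => -[/= Dx _ _]; move: xD; rewrite mem_set.
have Dx : D x by rewrite inE in xD.
(* The slice of [S] above [x] is a segment of length [w x]; this is where the density reappears. *)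
transitivity (\int[leb]_(y in `[0%R, w x]) (phi x ^+ n)%:E)%E.
  rewrite [RHS]integral_mkcond; apply: eq_integral => y _.
  rewrite /f !patchE /=; have -> : ((x, y) \in S) = (y \in `[0, w x]%classic).
    apply/idP/idP; rewrite !inE /S /= in_itv/=; first by case=> _ -> ->.
    by move=> /andP[].
  by rewrite xD.
rewrite integral_cst//= lebesgue_measure_itv/= lte_fin.
have := w0 _ Dx; rewrite le_eqVlt => /predU1P[<-|w_gt0].
  by rewrite ltxx mule0 mul0r.
by rewrite w_gt0 sube0 -EFinM mulrC.
Qed.

(** * Wallis integrals and the case of parameter one half *)

Lemma continuous_sin2X (R : realType) (k : nat) :
  continuous (fun x : R => (sin x ^+ 2) ^+ k).
Proof.
move=> x; apply: (@continuous_comp _ _ _ sin (fun y : R => (y ^+ 2) ^+ k)).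
  exact: continuous_sin.
apply: (@continuous_comp _ _ _ (fun y : R => y ^+ 2) (fun y => y ^+ k));
  exact: exprn_continuous.
Qed.

Lemma integrable_sin2X (R : realType) (k : nat) :
  (@lebesgue_measure R).-integrable `[0, pi]
    (EFin \o (fun x : R => (sin x ^+ 2) ^+ k)).
Proof.
apply: continuous_compact_integrable; first exact: segment_compact.
exact/continuous_subspaceT/continuous_sin2X.
Qed.

(** Integration by parts, packaged as one exact derivative: the difference of the two integrands is
    the derivative of [sin x ^+ (2 * n).+1 * cos x], which vanishes at 0 and at pi. *)
Lemma wallis_rec (R : realType) (n : nat) :
  let J k := \int[@lebesgue_measure R]_(x in `[0, pi]) (sin x ^+ 2) ^+ k in
  (2 * n.+1)%:R * J n.+1 = (2 * n).+1%:R * J n.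
Proof.
move=> J.
have intJ k := @integrable_sin2X R k.
pose f (x : R) : R := (2 * n).+1%:R * (sin x ^+ 2) ^+ n
                      - (2 * n.+1)%:R * (sin x ^+ 2) ^+ n.+1.
pose F (x : R) : R := sin x ^+ (2 * n).+1 * cos x.
have dF (x : R) : is_derive x 1 F (f x).
  rewrite (_ : F = sin ^+ (2 * n).+1 * cos); last first.
    by apply/funext => y; rewrite /F fctE /= exprfctE.
  apply: is_derive_eq; rewrite /GRing.scale/= /f fctE.
  rewrite [X in _ + X](_ : _ = (2 * n).+1%:R * sin x ^+ (2 * n) * (1 - sin x ^+ 2)).
    rewrite exprS (exprS (sin x ^+ 2)) -exprM; ring.
  by rewrite -cos2sin2; ring.
have derivF x : derivable F x 1 by apply: ex_derive; exact: dF.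
have contF : continuous F.
  by move=> x; apply/differentiable_continuous/derivable1_diffP.
have contf : continuous f.
  by move=> x; apply: cvgB; apply: cvgMr; exact: continuous_sin2X.
have FTC : (\int[lebesgue_measure]_(x in `[0%R, pi]) (f x)%:E = 0)%E.
  rewrite (@continuous_FTC2 R f F 0 pi (pi_gt0 R)).
  - by rewrite /F sinpi sin0 !expr0n/= !mul0r subee.
  - exact: continuous_subspaceT.
  - split=> [x _ //| |].
      exact/cvg_at_right_filter/contF.
    exact/cvg_at_left_filter/contF.
  - by move=> x _; rewrite derive1E; apply: derive_val.
apply/eqP; rewrite -subr_eq0 -opprB oppr_eq0.
rewrite -!RintegralZl// -RintegralB//.
- by rewrite /Rintegral FTC.
- exact: (integrableZl _ _ (intJ n)).
- exact: (integrableZl _ _ (intJ n.+1)).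
Qed.

Lemma hausdorff_moment_pochhammer_half (R : realType) :
  hausdorff_moment (fun n => pochhammer (1 / 2 : R) n / n`!%:R).
Proof.
pose W n := \int[@lebesgue_measure R]_(x in `[0, pi]) (pi^-1 * (sin x ^+ 2) ^+ n).
have pi0 : pi != 0 :> R by rewrite gt_eqF// pi_gt0.
have -> : (fun n => pochhammer (1 / 2 : R) n / n`!%:R) = W.
  apply/funext => n.
  rewrite /W RintegralZl//; last exact: integrable_sin2X.
  elim: n => [|n IHn].
    rewrite /pochhammer big_ord0 fact0 divr1.
    under eq_Rintegral do rewrite expr0.
    rewrite Rintegral_cst//= lebesgue_measure_itv/= lte_fin pi_gt0/=.
    by rewrite subr0 mul1r mulVf.
  (* Both sequences are multiplied by (2n+1)/(2n+2) = (n+1/2)/(n+1) when passing from n to n+1. *)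
  have n0 : (2 * n.+1)%:R != 0 :> R by rewrite pnatr_eq0.
  have := wallis_rec R n => /(canRL (mulKf n0)) ->.
  rewrite mulrCA (mulrCA pi^-1) -IHn /pochhammer big_ord_recr/= factS.
  have f0 : n`!%:R != 0 :> R by rewrite pnatr_eq0 -lt0n fact_gt0.
  rewrite -(natr1 (2 * n)) !natrM -natr1.
  by field; rewrite f0/= addrC natr1 pnatr_eq0.
apply: (@hausdorff_moment_density _ (measurableTypeR R) R (@lebesgue_measure R)
  `[0, pi] (cst pi^-1) (fun x => sin x ^+ 2)).
- exact: measurable_itv.
- apply: measurable_funX; apply: measurable_funTS.
  apply: continuous_measurable_fun; exact: continuous_sin.
- by move=> x _; rewrite invr_ge0 pi_ge0.
- by move=> x _; rewrite sqr_ge0/= sin2cos2 lerBlDr lerDl sqr_ge0.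
- apply: continuous_compact_integrable; first exact: segment_compact.
  by apply: continuous_subspaceT; exact: cst_continuous.
Qed.

(** * The fundamental theorem of calculus on an open half-line *)

(** Both ends are improper. The version for closed half-lines applies to [[a + 1/(n+1), +oo[], and
    monotone convergence lets the left end tend to [a]; this is why [f] is taken nonnegative. *)
Lemma ge0_FTC2_oy (R : realType) (f F : R -> R) (a l0 l : R) :
  (forall x, a < x -> 0 <= f x) -> (forall x, a < x -> {for x, continuous f}) ->
  (forall x, a < x -> is_derive x 1 F (f x)) ->
  F x @[x --> a^'+] --> l0 -> F x @[x --> +oo] --> l ->
  (\int[lebesgue_measure]_(x in `]a, +oo[) (f x)%:E = l%:E - l0%:E)%E.
Proof.
move=> f0 cf dF Fa Fy.
pose e (n : nat) : R := a + n.+1%:R^-1.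
have ae n : a < e n by rewrite ltrDl invr_gt0.
pose E (n : nat) : set R := `[e n, +oo[%classic.
have UE : \bigcup_n E n = `]a, +oo[%classic.
  apply/seteqP; split=> x /=; rewrite /E/= ?in_itv/= ?andbT.
    by move=> [n _ /=]; rewrite in_itv/= andbT; exact: lt_le_trans.
  move=> ax; have xa0 : 0 < x - a by rewrite subr_gt0.
  (* With this [n], [n.+1] exceeds the inverse of [x - a], hence [e n <= x]. *)
  exists (Num.truncn (x - a)^-1) => //=; rewrite in_itv/= andbT /e.
  rewrite addrC -lerBrDr -[leRHS]invrK lef_pV2 ?posrE ?invr_gt0//.
  by rewrite ltW// truncnS_gt.
have mf n : measurable_fun (E n) (EFin \o f).
  apply/measurable_EFinP.
  apply: (@measurable_funS _ _ _ _ `]a, +oo[%classic) => //.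
    by move=> x; rewrite /E /= !in_itv/= !andbT; exact/lt_le_trans/ae.
  apply: open_continuous_measurable_fun; first exact: interval_open.
  by move=> x; rewrite inE/= in_itv/= andbT; exact: cf.
have ndE : {homo E : n m / (n <= m)%N >-> (n <= m)%O}.
  move=> n m nm; apply/subsetPset => x; rewrite /E/= !in_itv/= !andbT.
  by apply: le_trans; rewrite lerD2l lef_pV2 ?posrE// ler_nat.
have := @ge0_nondecreasing_set_cvg_integral _ (measurableTypeR R) R E (EFin \o f)
  (@lebesgue_measure R) ndE (fun n => measurable_itv _) mf.
rewrite UE => /(_ _)/cvg_lim <-//; last first.
  move=> n x; rewrite /E/= in_itv/= andbT => ex.
  by rewrite lee_fin f0// (lt_le_trans (ae n)).
apply/cvg_lim => //.
have -> : (fun n => \int[lebesgue_measure]_(x in E n) (f x)%:E)%E =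
    (fun n => (l - F (e n))%:E).
  apply/funext => n; rewrite EFinB.
  apply: ge0_continuous_FTC2y => //.
  - by move=> x ex; rewrite f0// (lt_le_trans (ae n)).
  - apply: continuous_in_subspaceT => x; rewrite inE/= in_itv/= andbT => ex.
    by apply: cf; exact: (lt_le_trans (ae n)).
  - by move=> x ex; have := dF _ (lt_trans (ae n) ex) => -[].
  - apply: cvg_at_right_filter; apply: differentiable_continuous.
    by apply/derivable1_diffP; have [] := dF _ (ae n).
  - move=> x; rewrite in_itv/= andbT => ex; rewrite derive1E.
    by have := dF _ (lt_trans (ae n) ex) => -[].
apply: cvg_EFin; first exact: nearW.
apply: cvgB; first exact: cvg_cst.
move/cvg_at_rightP : Fa; apply; split => //.
rewrite -[X in _ --> X]addr0; apply: cvgD; first exact: cvg_cst.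
exact: cvg_harmonic.
Qed.

(** * An explicit majorant for the Gamma integrand *)

(** Raise [x / p <= 1 + x / p <= expR (x / p)] to the power [p]. *)
Lemma powR_expRN_le (R : realType) (p x : R) :
  0 < p -> 0 < x -> x `^ p * expR (- x) <= p `^ p.
Proof.
move=> p0 x0; have xp0 : 0 < x / p by rewrite divr_gt0.
have xE : x = x / p * p by rewrite divfK// gt_eqF.
rewrite expRN ler_pdivrMr ?expR_gt0// [in leLHS]xE [in leRHS]xE.
rewrite powRM ?(ltW xp0) ?(ltW p0)// mulrC ler_pM2l ?powR_gt0// expRM.
rewrite ge0_ler_powR ?nnegrE ?expR_ge0 ?ltW//.
by rewrite (lt_le_trans _ (expR_ge1Dx _))// ltrDr.
Qed.

(* Dominates both [x `^ (s - 1) * expR (- x)] and [x `^ s * expR (- x)], and has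
   the explicit primitive [- (1 + x `^ s)^-1]. *)
Definition gamma_major (R : realType) (s x : R) : R :=
  s * x `^ (s - 1) / (1 + x `^ s) ^+ 2.

Lemma gamma_major_ge0 (R : realType) (s x : R) : 0 < s -> 0 <= gamma_major s x.
Proof.
by move=> s0; rewrite divr_ge0 ?sqr_ge0// mulr_ge0 ?powR_ge0// ltW.
Qed.

Lemma powRD1_neq0 (R : realType) (s x : R) : 1 + x `^ s != 0.
Proof. by rewrite gt_eqF// ltr_pwDl// powR_ge0. Qed.

(** Once [x]^ (s - 1)[is factored out, the remaining factors 1 and]x[are both at most]1 +
    x[, so a single bound on](1 + x) * (1 + x [^ s) ^+ 2 * expR (- x)] serves for both
    inequalities. *)
Lemma gamma_majorP (R : realType) (s : R) : 0 < s ->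
  exists2 M : R, 0 <= M & forall x, 0 < x ->
    x `^ (s - 1) * expR (- x) <= M * gamma_major s x /\
    x `^ s * expR (- x) <= M * gamma_major s x.
Proof.
move=> s0; pose p := s * 2.
have p0 : 0 < p by rewrite mulr_gt0.
pose B : R := 2 * (1 + 1 `^ 1 + p `^ p + (p + 1) `^ (p + 1)).
have bound (x : R) : 0 < x -> (1 + x) * (1 + x `^ s) ^+ 2 * expR (- x) <= B.
  move=> x0.
  have e1 : expR (- x) <= 1 by rewrite expR_le1 oppr_le0 ltW.
  have b1 := @powR_expRN_le R 1 x ltr01 x0.
  have b2 := powR_expRN_le p0 x0.
  have b3 := powR_expRN_le (addr_gt0 p0 ltr01) x0.
  have u2 : x `^ p = (x `^ s) ^+ 2.
    by rewrite /p powRrM powR_mulrn ?powR_ge0.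
  have u3 : x `^ (p + 1) = (x `^ s) ^+ 2 * x.
    by rewrite powRD ?u2 ?powRr1 ?(ltW x0)// (gt_eqF x0) implybT.
  rewrite u2 in b2; rewrite u3 in b3; rewrite powRr1 ?(ltW x0)// in b1.
  rewrite /B; have e0 := expR_ge0 (- x).
  move: e0 e1 b1 b2 b3; set e := expR _; set u := x `^ s => e0 e1 b1 b2 b3.
  have : (1 + x) * (1 + u) ^+ 2 * e <= 2 * (e + x * e + u ^+ 2 * e + u ^+ 2 * x * e).
    rewrite -subr_ge0.
    rewrite (_ : _ - _ = (1 + x) * e * (1 - u) ^+ 2); last by ring.
    by rewrite mulr_ge0 ?sqr_ge0// mulr_ge0// ltW// addr_gt0.
  move=> /le_trans; apply; rewrite ler_pM2l//; lra.
(* Division by [s] compensates the factor [s] in [gamma_major]. *)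
exists (B / s).
  by rewrite divr_ge0 ?(ltW s0)// mulr_ge0// !addr_ge0 ?powR_ge0.
move=> x x0; have {bound}:= bound _ x0.
have u0 : 0 < (1 + x `^ s) ^+ 2 by rewrite exprn_gt0// ltr_pwDl// powR_ge0.
have -> : B / s * gamma_major s x = x `^ (s - 1) * (B / (1 + x `^ s) ^+ 2).
  by rewrite /gamma_major; field; rewrite powRD1_neq0 gt_eqF.
move=> b; have {}b : (1 + x) * expR (- x) <= B / (1 + x `^ s) ^+ 2.
  by rewrite ler_pdivlMr// mulrAC.
have e0 := expR_ge0 (- x); split.
  rewrite ler_wpM2l ?powR_ge0// (le_trans _ b)//.
  by rewrite ler_peMl// lerDl ltW.
rewrite -[in leLHS](mulr_powRB1 (ltW x0) s0) mulrAC mulrC.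
rewrite ler_wpM2l ?powR_ge0// (le_trans _ b)//.
by rewrite ler_wpM2r// lerDr.
Qed.

Lemma is_derive_gamma_major (R : realType) (s x : R) : 0 < x ->
  is_derive x 1 (fun y => - (1 + y `^ s)^-1) (gamma_major s x).
Proof.
move=> x0.
have d1 : is_derive x 1 (fun y : R => 1 + y `^ s) (s * x `^ (s - 1)).
  rewrite (_ : (fun y => _) = cst 1 + (fun y : R => y `^ s)) //.
  by have ? := is_derive1_powR s x0; apply: is_derive_eq; rewrite add0r.
have -> : gamma_major s x = - (- (1 + x `^ s) ^- 2 *: (s * x `^ (s - 1))).
  by rewrite scaleNr opprK /gamma_major /GRing.scale/= mulrC.
exact: (is_deriveN (@is_deriveV R (fun y => 1 + y `^ s) x _ 1
  (powRD1_neq0 s x) d1)).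
Qed.

Lemma continuous_powR_gt0 (R : realType) (p x : R) : 0 < x ->
  {for x, continuous (fun y : R => y `^ p)}.
Proof.
move=> x0; apply: differentiable_continuous; apply/derivable1_diffP.
by have [] := is_derive1_powR p x0.
Qed.

Lemma continuous_gamma_major (R : realType) (s x : R) : 0 < x ->
  {for x, continuous (gamma_major s)}.
Proof.
move=> x0; have cs := @continuous_powR_gt0 R s x x0.
have cs1 := @continuous_powR_gt0 R (s - 1) x x0.
apply: cvgM; first by apply: cvgMr; exact: cs1.
apply: cvgV; first by rewrite expf_neq0// powRD1_neq0.
apply: (@continuous_comp _ _ _ (fun y : R => 1 + y `^ s) (fun y => y ^+ 2)).
  by apply: cvgD; [exact: cvg_cst|exact: cs].
exact: exprn_continuous.
Qed.

Lemma cvg_at_right_gamma_major (R : realType) (s : R) : 0 < s ->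
  - (1 + x `^ s)^-1 @[x --> 0^'+] --> (-1 : R).
Proof.
move=> s0.
apply: cvgN; rewrite -[X in _ --> X]invr1; apply: cvgV; first exact: oner_neq0.
rewrite -[X in _ --> X]addr0; apply: cvgD; first exact: cvg_cst.
exact: powR_cvg0.
Qed.

Lemma cvgy_gamma_major (R : realType) (s : R) : 0 < s ->
  - (1 + x `^ s)^-1 @[x --> +oo] --> (0 : R).
Proof.
move=> s0; rewrite -[X in _ --> X]oppr0; apply: cvgN.
apply/gtr0_cvgV0; first by apply: nearW => x; rewrite ltr_pwDl// powR_ge0.
apply/cvgryPge => A; near=> x.
rewrite (le_trans (ler_norm A))//.
have x0 : 0 <= x by near: x; exact: nbhs_pinfty_ge.
have -> : `|A| = (`|A| `^ s^-1) `^ s by rewrite -powRrM mulVf ?gt_eqF// powRr1.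
rewrite (@le_trans _ _ (x `^ s)) ?lerDr//.
by rewrite ge0_ler_powR ?nnegrE ?powR_ge0 ?(ltW s0).
Unshelve. all: by end_near. Qed.

Lemma integral_gamma_major (R : realType) (s : R) : 0 < s ->
  (\int[lebesgue_measure]_(x in `]0%R, +oo[) (gamma_major s x)%:E = 1)%E.
Proof.
move=> s0.
transitivity (0%:E - (-1 : R)%:E)%E; last by rewrite -EFinB opprK add0r.
apply: (@ge0_FTC2_oy R _ (fun y => - (1 + y `^ s)^-1)).
- by move=> x _; exact: gamma_major_ge0.
- by move=> x x0; exact: continuous_gamma_major.
- by move=> x x0; exact: is_derive_gamma_major.
- exact: cvg_at_right_gamma_major.
- exact: cvgy_gamma_major.
Qed.

Lemma integrable_gamma_major (R : realType) (s : R) : 0 < s ->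
  (@lebesgue_measure R).-integrable `]0, +oo[ (EFin \o gamma_major s).
Proof.
move=> s0; apply/integrableP; split.
  apply/measurable_EFinP.
  apply: open_continuous_measurable_fun; first exact: interval_open.
  by move=> x; rewrite inE/= in_itv/= andbT; exact: continuous_gamma_major.
under eq_integral do rewrite /= ger0_norm ?gamma_major_ge0//.
by rewrite integral_gamma_major// ltry.
Qed.

Lemma measurable_powR_expRN (R : realType) (p : R) :
  measurable_fun setT (fun x : measurableTypeR R => x `^ p * expR (- x)).
Proof.
apply: measurable_funM; first exact: measurable_powR.
apply: (measurableT_comp (f := expR)); first exact: measurable_expR.
exact: oppr_measurable.
Qed.

Lemma integrable_powR_expRN (R : realType) (s : R) : 0 < s ->
  (@lebesgue_measure R).-integrable `]0, +oo[
    (EFin \o (fun x => x `^ (s - 1) * expR (- x))).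
Proof.
move=> s0; have [M M0 HM] := gamma_majorP s0.
apply: (le_integrable _ _ _ (integrableZl _ M (integrable_gamma_major s0))) => //.
  by apply/measurable_EFinP; apply: measurable_funTS; exact: measurable_powR_expRN.
move=> x /=; rewrite in_itv/= andbT => x0.
rewrite lee_fin ger0_norm ?mulr_ge0 ?powR_ge0 ?expR_ge0//.
by rewrite (le_trans (HM _ x0).1)// ler_norm.
Qed.

(** * The recurrence of the Gamma function *)

(** The uniform bound at exponent [s + 1], divided by [x], gives decay of order 1/x. *)
Lemma cvgy_powR_expRN (R : realType) (s : R) : 0 < s ->
  x `^ s * expR (- x) @[x --> +oo] --> (0 : R).
Proof.
move=> s0; have s1 : 0 < s + 1 by rewrite addr_gt0.
apply: (@squeeze_cvgr _ _ _ _ (cst 0) (fun x => (s + 1) `^ (s + 1) * x^-1)).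
- near=> x; rewrite mulr_ge0 ?powR_ge0 ?expR_ge0//=.
  have x0 : 0 < x by near: x; exact: nbhs_pinfty_gt.
  rewrite ler_pdivlMr// mulrAC (le_trans _ (powR_expRN_le s1 x0))//.
  by rewrite powRD ?powRr1 ?(ltW x0)// (gt_eqF x0) implybT.
- exact: cvg_cst.
- rewrite -[X in _ --> X](mulr0 ((s + 1) `^ (s + 1))); apply: cvgMr.
  apply/gtr0_cvgV0; last exact: cvg_id.
  exact: nbhs_pinfty_gt.
Unshelve. all: by end_near. Qed.

Lemma continuous_powR_expRN (R : realType) (p x : R) : 0 < x ->
  {for x, continuous (fun y => y `^ p * expR (- y))}.
Proof.
move=> x0; apply: cvgM; first exact: continuous_powR_gt0.
apply: (@continuous_comp _ _ _ -%R expR); first exact: opp_continuous.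
exact: continuous_expR.
Qed.

Lemma is_derive_powR_expRN (R : realType) (s x : R) : 0 < x ->
  is_derive x 1 (fun y => y `^ s * expR (- y))
    (s * (x `^ (s - 1) * expR (- x)) - x `^ s * expR (- x)).
Proof.
move=> x0.
have dE : is_derive x 1 (expR \o -%R) (- expR (- x)).
  by apply: is_derive_eq; rewrite /GRing.scale/= mulrN1.
have -> : s * (x `^ (s - 1) * expR (- x)) - x `^ s * expR (- x) =
    x `^ s *: (- expR (- x)) + expR (- x) *: (s * x `^ (s - 1)).
  by rewrite /GRing.scale/=; ring.
exact: (@is_deriveM R R (fun y => y `^ s) (expR \o -%R) x 1 _ _
  (is_derive1_powR s x0) dE).
Qed.

(** Integration by parts: [s * p - q] is the derivative of [q], which tends to 0 at both ends. Since
    this derivative changes sign, a multiple of [gamma_major] is added to make it nonnegative, and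
    its known integral is subtracted at the end. *)
Lemma GammaS (R : realType) (s : R) : 0 < s -> Gamma (s + 1) = s * Gamma s.
Proof.
move=> s0; have [M M0 HM] := gamma_majorP s0.
have s1 : 0 < s + 1 by rewrite addr_gt0.
pose p (x : R) := x `^ (s - 1) * expR (- x).
pose q (x : R) := x `^ s * expR (- x).
pose g (x : R) := s * p x - q x + M * gamma_major s x.
have ip := integrable_powR_expRN s0.
have iq : (@lebesgue_measure R).-integrable `]0, +oo[ (EFin \o q).
  by have := integrable_powR_expRN s1; rewrite addrK.
have igm := integrable_gamma_major s0.
have : \int[lebesgue_measure]_(x in `]0, +oo[) g x = M.
  rewrite /Rintegral.
  (* The primitive tends to 0 at infinity and to [- M] at 0; the latter comes from the majorant
     alone. *)
  rewrite (_ : (\int[_]_(_ in _) _)%E = (0%:E - (- M)%:E)%E).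
    by rewrite -EFinB opprK add0r.
  apply: (@ge0_FTC2_oy R _ (fun x => q x + M * - (1 + x `^ s)^-1)).
  - move=> x x0; rewrite /g -addrA addr_ge0//.
      by rewrite !mulr_ge0 ?powR_ge0 ?expR_ge0// ltW.
    by rewrite addrC subr_ge0; exact: (HM _ x0).2.
  - move=> x x0; apply: cvgD; last first.
      by apply: cvgMr; exact: continuous_gamma_major.
    apply: cvgB; last exact: continuous_powR_expRN.
    by apply: cvgMr; exact: continuous_powR_expRN.
  - move=> x x0.
    have d1 := is_derive_powR_expRN s x0.
    have d2 := is_deriveZ M (is_derive_gamma_major s x0).
    exact: (is_deriveD d1 d2).
  - rewrite -[- M]add0r -[- M]mulrN1; apply: cvgD; last first.
      by apply: cvgMr; exact: cvg_at_right_gamma_major.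
    rewrite -[X in _ --> X](mul0r (expR (- 0))); apply: cvgM.
      exact: powR_cvg0.
    apply: cvg_at_right_filter.
    apply: (@continuous_comp _ _ _ -%R expR); first exact: opp_continuous.
    exact: continuous_expR.
  - rewrite -[X in _ --> X]addr0 -[in X in _ --> _ + X](mulr0 M); apply: cvgD.
      exact: cvgy_powR_expRN.
    by apply: cvgMr; exact: cvgy_gamma_major.
have isp : (@lebesgue_measure R).-integrable `]0, +oo[ (EFin \o (fun x => s * p x)).
  exact: (integrableZl _ s ip).
have iMm : (@lebesgue_measure R).-integrable `]0, +oo[
    (EFin \o (fun x => M * gamma_major s x)).
  exact: (integrableZl _ M igm).
rewrite RintegralD//; last exact: (integrableB _ isp iq).
rewrite RintegralB// !RintegralZl//.
rewrite {3}/Rintegral integral_gamma_major//= mulr1.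
move=> /(canRL (addrK M)) /eqP; rewrite subrr subr_eq0 => /eqP sG.
by rewrite /Gamma addrK -/p sG.
Qed.

Lemma GammaDn (R : realType) (s : R) (k : nat) :
  0 < s -> Gamma (k%:R + s) = pochhammer s k * Gamma s.
Proof.
move=> s0; elim: k => [|k IHk]; first by rewrite add0r /pochhammer big_ord0 mul1r.
rewrite -natr1 addrAC GammaS ?ltr_wpDl// IHk /pochhammer big_ord_recr/=.
by rewrite [s + _]addrC; ring.
Qed.

Lemma Gamma_ge0 (R : realType) (s : R) : 0 <= Gamma s.
Proof.
by apply: Rintegral_ge0 => x _; rewrite mulr_ge0 ?powR_ge0 ?expR_ge0.
Qed.

Lemma Beta_ge0 (R : realType) (a b : R) : 0 <= Beta a b.
Proof. by apply: Rintegral_ge0 => x _; rewrite mulr_ge0 ?powR_ge0. Qed.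

(** * Assembly of the two sequences *)

Lemma hausdorff_moment_pochhammer (R : realType) (d : nat) :
  d = 1%N \/ d = 2%N ->
  hausdorff_moment (fun n => pochhammer (d%:R / 2 : R) n / n`!%:R).
Proof.
move=> [|] ->; first exact: hausdorff_moment_pochhammer_half.
have -> : (fun n => pochhammer (2 / 2 : R) n / n`!%:R) = fun=> 1.
  apply/funext => n; rewrite divff ?pnatr_eq0//.
  have -> : pochhammer (1 : R) n = n`!%:R.
    elim: n => [|n IHn]; first by rewrite /pochhammer big_ord0.
    by rewrite factS natrM -IHn /pochhammer big_ord_recr/= mulrC nat1r.
  by rewrite divff// pnatr_eq0 -lt0n fact_gt0.
exact: hausdorff_moment1.
Qed.

(* If [w] is not integrable, neither is any [w * phi ^+ n], and every term is the
   junk value [0] of [Rintegral]. *)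
Lemma hausdorff_moment_density_lb d (T : measurableType d) (R : realType)
    (mu : {sigma_finite_measure set T -> \bar R}) (D : set T) (w phi : T -> R)
    (c : R) :
  measurable D -> measurable_fun D w -> measurable_fun D phi -> 0 < c ->
  (forall x, D x -> 0 <= w x) -> (forall x, D x -> c <= phi x <= 1) ->
  hausdorff_moment (fun n => \int[mu]_(x in D) (w x * phi x ^+ n)).
Proof.
move=> mD mw mphi c0 w0 cphi.
have phi0 x : D x -> 0 <= phi x.
  by move=> /cphi /andP[+ _]; apply: le_trans; exact: ltW.
have [iw|niw] := pselect (mu.-integrable D (EFin \o w)).
  apply: hausdorff_moment_density => // x Dx.
  by rewrite phi0//; have /andP[] := cphi _ Dx.
(* The zero sequence, written as a multiple of the constant sequence 1 so that scaling applies. *)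
have -> : (fun n => \int[mu]_(x in D) (w x * phi x ^+ n)) = fun=> 0 * 1.
  apply/funext => n; rewrite mul0r /Rintegral.
  have mwp : measurable_fun D (EFin \o (fun x => w x * phi x ^+ n)).
    by apply/measurable_EFinP; apply: measurable_funM => //; exact: measurable_funX.
  have wp0 x : D x -> 0 <= w x * phi x ^+ n.
    by move=> Dx; rewrite mulr_ge0 ?w0 ?exprn_ge0 ?phi0.
  (* [fine] sends [+oo] to 0. *)
  suff -> : (\int[mu]_(x in D) (w x * phi x ^+ n)%:E = +oo)%E by [].
  apply/eqP; rewrite -leye_eq leNgt; apply/negP => lty; apply: niw.
  have iwp : mu.-integrable D (EFin \o (fun x => w x * phi x ^+ n)).
    apply/integrableP; split => //.
    under eq_integral => x xD.
      rewrite /= ger0_norm ?wp0//; last by rewrite inE in xD.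
      over.
    exact: lty.
  (* Since [c <= phi], [w] is at most [c ^- n] times [w * phi ^+ n], so integrability would pass
     back to [w]. *)
  apply: (le_integrable _ _ _ (integrableZl _ (c ^- n) iwp)) => //.
    exact/measurable_EFinP.
  move=> x Dx /=; rewrite lee_fin !ger0_norm ?w0//.
  - rewrite mulrC -mulrA ler_peMr ?w0// ler_pdivlMr ?exprn_gt0// mul1r.
    by rewrite lerXn2r ?nnegrE ?phi0 ?(ltW c0)//; have /andP[] := cphi _ Dx.
  - by rewrite mulr_ge0 ?wp0// invr_ge0 exprn_ge0// ltW.
by apply: hausdorff_momentZ => //; exact: hausdorff_moment1.
Qed.

Lemma hausdorff_moment_cseq (R : realType) (d : nat) (nu mu : R) :
  d = 1%N \/ d = 2%N -> hausdorff_moment (cseq d nu mu).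
Proof.
move=> d12.
have h := hausdorff_momentM (hausdorff_moment_pochhammer R d12).
pose I n := \int[@lebesgue_measure R]_(t in `[0, 1])
  ((t `^ (mu + d%:R / 2 - 1) * (1 - t) `^ (nu + d%:R / 2 - 1))
   * (1 - t + t ^+ 2) ^+ n).
have -> : cseq d nu mu = fun n =>
    pochhammer (d%:R / 2) n / n`!%:R * ((Beta nu mu)^-1 * I n).
  by apply/funext => n; rewrite /cseq -/(I n) div1r [RHS]mulrCA mulrA.
apply/h/hausdorff_momentZ; first by rewrite invr_ge0 Beta_ge0.
(* The constant is the minimum of 1 - t + t^2 = (t - 1/2)^2 + 3/4. The upper bound 1 amounts to t(1
   - t) >= 0. *)
apply: (@hausdorff_moment_density_lb _ (measurableTypeR R) R
  (@lebesgue_measure R) _ _ _ (3 / 4)) => //.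
- apply: measurable_funTS; apply: measurable_funM; first exact: measurable_powR.
  apply: (measurableT_comp (f := fun x => x `^ _)); first exact: measurable_powR.
  exact: measurable_funB.
- apply: measurable_funTS; apply: measurable_funD; last exact: measurable_funX.
  exact: measurable_funB.
- by move=> x _; rewrite mulr_ge0 ?powR_ge0.
- move=> t /=; rewrite in_itv/= => /andP[t0 t1].
  have ht := sqr_ge0 (t - 1 / 2).
  by apply/andP; split; nra.
Qed.

Lemma hausdorff_moment_alpha (R : realType) (d : nat) (nu gam : R) :
  d = 1%N \/ d = 2%N -> 0 < nu -> 0 < gam -> hausdorff_moment (alpha d nu gam).
Proof.
move=> d12 nu0 gam0; pose h : R := d%:R / 2; pose g2 := gam ^+ 2.
have h0 : 0 < h by case: d12 => -> in h *; rewrite divr_gt0.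
have g20 : 0 < g2 by rewrite exprn_gt0.
(* The power of [a + g2] with exponent [- k%:R - h] is split: the part independent of [k] goes into
   the weight, and the rest, together with [gam ^+ (2 * k)], becomes the [k]-th power of [phi a],
   that is of g2/(a + g2). *)
pose w (a : R) := a `^ (nu + h - 1) * expR (- a) * (a + g2) `^ (- h).
pose phi (a : R) := g2 * (a + g2) `^ (-1).
have mpow p : measurable_fun setT (fun a : measurableTypeR R => (a + g2) `^ p).
  apply: (measurableT_comp (f := fun x => x `^ _)); first exact: measurable_powR.
  exact: measurable_funD.
have mphi : measurable_fun setT (phi : measurableTypeR R -> R).
  exact: measurable_funM.
have w0 a : 0 <= w a by rewrite !mulr_ge0 ?powR_ge0 ?expR_ge0.
have phi01 a : 0 < a -> 0 <= phi a <= 1.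
  move=> a0; rewrite mulr_ge0 ?powR_ge0 ?(ltW g20)//=.
  have ag0 : 0 < a + g2 by rewrite addr_gt0.
  by rewrite /phi powR_inv1 ?(ltW ag0)// ler_pdivrMr// mul1r lerDr ltW.
(* Bounding [(a + g2)]^ (- h)[by]g2 [^ (- h)] leaves a Gamma integrand with parameter [nu + h]. *)
have iw : (@lebesgue_measure R).-integrable `]0, +oo[ (EFin \o w).
  have := integrable_powR_expRN (addr_gt0 nu0 h0).
  move=> /(integrableZl _ (g2 `^ (- h))) iC.
  apply: (le_integrable _ _ _ (iC _)) => //.
    apply/measurable_EFinP; apply: measurable_funTS; apply: measurable_funM => //.
    exact: measurable_powR_expRN.
  move=> a /=; rewrite in_itv/= andbT => a0.
  rewrite lee_fin ger0_norm// ger0_norm ?mulr_ge0 ?powR_ge0 ?expR_ge0//.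
  rewrite /w mulrC ler_wpM2r ?mulr_ge0 ?powR_ge0 ?expR_ge0//.
  rewrite !powRN lef_pV2 ?posrE ?powR_gt0 ?addr_gt0//.
  by rewrite ge0_ler_powR ?nnegrE ?(ltW h0) ?ltW ?addr_gt0 ?ltrDr// lerDr ltW.
pose I n := \int[@lebesgue_measure R]_(a in `]0, +oo[) (w a * phi a ^+ n).
have HI : hausdorff_moment I.
  apply: (@hausdorff_moment_density _ (measurableTypeR R) R (@lebesgue_measure R)).
  - exact: measurable_itv.
  - exact: measurable_funTS.
  - by move=> a _.
  - by move=> a /=; rewrite in_itv/= andbT; exact: phi01.
  - exact: iw.
(* The quotient [Gamma h / Gamma h] stays uncancelled: it enters only as a nonnegative constant,
   which is all that scaling asks for. *)
have -> : alpha d nu gam = fun k =>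
    pochhammer h k / k`!%:R * (Gamma h / Gamma h / Gamma nu * I k).
  apply/funext => k; rewrite /alpha -/h GammaDn//.
  have -> : \int[lebesgue_measure]_(a in `]0, +oo[)
      (expR (- a) * a `^ (nu + h - 1) * (a + gam ^+ 2) `^ (- k%:R - h)) =
      (g2 ^+ k)^-1 * I k.
    rewrite /I -RintegralZl//; last first.
      apply: le1_integrableM => //.
        by apply: measurable_funX; exact: measurable_funTS.
      move=> a /=; rewrite in_itv/= andbT => /phi01 /andP[p0 p1].
      by rewrite exprn_ge0// exprn_ile1.
    apply: eq_Rintegral => a; rewrite inE/= in_itv/= andbT => a0.
    have ag0 : 0 < a + g2 by rewrite addr_gt0.
    rewrite -/g2 (@powRD R (a + g2)) ?(gt_eqF ag0) ?implybT// powR_invn ?(ltW ag0)//.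
    rewrite /w /phi powR_inv1 ?(ltW ag0)// expr_div_n.
    have : g2 ^+ k != 0 by rewrite expf_neq0 ?gt_eqF.
    by move: (g2 ^+ k) ((a + g2) ^- k) => u v u0; field.
  rewrite exprM -/g2 [LHS]mulrA mulfK ?expf_neq0 ?gt_eqF//.
  by rewrite !invfM; ring.
apply: hausdorff_momentM; first exact: hausdorff_moment_pochhammer.
by apply: hausdorff_momentZ => //; rewrite !mulr_ge0 ?invr_ge0 ?Gamma_ge0.
Qed.

Theorem theorem6 (R : realType) (d : nat) (nu mu gam : R) :
  (d = 1%N \/ d = 2%N) -> 0 < nu -> 0 < mu -> 0 < gam ->
  hausdorff_moment (alpha d nu gam) /\ hausdorff_moment (cseq d nu mu).
Proof.
move=> d12 nu0 _ gam0; split; first exact: hausdorff_moment_alpha.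
exact: hausdorff_moment_cseq.
Qed.
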